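(* Let $r\ge1$ and let $b_1\ge\cdots\ge b_r$ be integers with $b_i\ge i$ for all $i$. Let $I=[x,y]$ be any interval of the augmented Ferrers-cell lattice $\widehat F_{\mathbf b}=F_{\mathbf b}\sqcup\{\widehat0\}$, and give $I$ the induced rank function $\widehat\rho_I(z)=\widehat\rho(z)-\widehat\rho(x)$. Then $$\mathbb{H}_{I,\widehat\rho_I}(q,t)\in\mathbb{N}[q,t].$$
   Context: $\mathbb N=\{0,1,2,\dots\}$. $q$-Zeta numerator: let $P$ be a finite graded poset with a unique maximum and rank function $\rho:P\to\{0,\dots,H\}$, where $H$ is the maximal rank. For $m\ge 0$ put $A_m(P,\rho;q)=\sum_{x_1\le\cdots\le x_m}q^{\rho(x_1)+\cdots+\rho(x_m)}$ (sum over weak chains in $P$; $A_0=1$). The numerator $\mathbb{H}_{P,\rho}(q,t)$ is the polynomial determined by $\sum_{m\ge 0}A_m(P,\rho;q)t^m=\mathbb{H}_{P,\rho}(q,t)/\prod_{a=0}^{H}(1-q^at)$. Ferrers-cell poset: $F_{\mathbf b}=\{(i,c):1\le i\le r,\ i\le c\le b_i\}$, ordered by $(i,c)\le(j,d)\iff i\ge j$ and $c\le d$. $\widehat F_{\mathbf b}$ is obtained by adjoining a new minimum $\widehat0$ below every cell, with rank $\widehat\rho(\widehat0)=0$ and $\widehat\rho(i,c)=c-i+1$. *)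

(* Defs.v *)
From HB Require Import structures.
From mathcomp Require Import all_boot all_order all_algebra.

Set Implicit Arguments.
Unset Strict Implicit.
Unset Printing Implicit Defensive.

Import Order.TTheory GRing.Theory Num.Theory.

Local Open Scope ring_scope.

(* Posets are subsets P : {set T} of a finite poset T, with the induced order;
   a whole poset T is [set: T].  Elements of Z[q] are of type {poly int}, and
   elements of Z[q][t] of type {poly {poly int}} (the outer variable is t).   *)
Section QZeta.

Variables (d : Order.disp_t) (T : finPOrderType d).
Implicit Types (P : {set T}) (rho : T -> nat).

Definition weak_chain P (s : seq T) : bool :=
  all [in P] s && sorted (fun x y => (x <= y)%O) s.

Definition qzeta P rho (m : nat) : {poly int} :=
  \sum_(s : m.-tuple T | weak_chain P s) 'X^(\sum_(x <- s) rho x)%N.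

Definition max_rank P rho : nat := (\max_(x in P) rho x)%N.

Definition qzeta_denominator P rho : {poly {poly int}} :=
  \prod_(a < (max_rank P rho).+1) (1 - ('X^a : {poly int}) *: 'X).

(* The identity of power series in t
     (\prod_(a <= H) (1 - q^a t)) * (\sum_m A_m t^m) = N,
   read coefficientwise.  It determines N (qzeta_numerator_uniq below); that
   the left-hand side is a polynomial in t is not built in. *)
Definition is_qzeta_numerator P rho (N : {poly {poly int}}) : Prop :=
  forall n : nat,
    \sum_(k < n.+1) (qzeta_denominator P rho)`_k * qzeta P rho (n - k) = N`_n.

Lemma qzeta_numerator_uniq P rho (N1 N2 : {poly {poly int}}) :
  is_qzeta_numerator P rho N1 -> is_qzeta_numerator P rho N2 -> N1 = N2.
Proof. by move=> h1 h2; apply/polyP => n; rewrite -h1 -h2. Qed.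

Definition order_interval (x y : T) : {set T} := [set z | (x <= z <= y)%O].

Definition interval_rank rho (x : T) (z : T) : nat := (rho z - rho x)%N.

End QZeta.

Definition ferrers_cells (r : nat) (b : nat -> nat) : seq (nat * nat) :=
  [seq (i, c) | i <- iota 1 r, c <- iota i ((b i).+1 - i)].

Lemma mem_ferrers_cells r b i c :
  ((i, c) \in ferrers_cells r b) = (1 <= i <= r)%N && (i <= c <= b i)%N.
Proof.
apply/allpairsPdep/andP => [[j [e [hj he [-> ->]]]]|[hi hc]].
  move: hj he; rewrite !mem_iota => /andP[-> hj] /andP[hje he].
  rewrite -ltnS -[r.+1]add1n hj hje; split=> //=.
  case: (leqP j (b j).+1) => hb; first by rewrite subnKC in he.
  move: he; rewrite (eqP (ltnW hb)) addn0 => /(leq_ltn_trans hje).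
  by rewrite ltnn.
case/andP: hi => i0 ir; case/andP: hc => ic cb.
exists i, c; rewrite !mem_iota i0 add1n ltnS ir ic; split=> //=.
by rewrite subnKC ?ltnS // leqW // (leq_trans ic).
Qed.

Definition ferrers_cell (r : nat) (b : nat -> nat) : Type :=
  seq_sub (ferrers_cells r b).

HB.instance Definition _ r b := Finite.on (ferrers_cell r b).

Definition cell_le r b (u v : ferrers_cell r b) : bool :=
  ((val v).1 <= (val u).1)%N && ((val u).2 <= (val v).2)%N.

(* [None] is the adjoined minimum. *)
Definition aug_ferrers (r : nat) (b : nat -> nat) : Type :=
  option (ferrers_cell r b).

HB.instance Definition _ r b := Finite.on (aug_ferrers r b).

Definition aug_le r b (u v : aug_ferrers r b) : bool :=
  match u, v with
  | None, _ => true
  | Some _, None => false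
  | Some u', Some v' => cell_le u' v'
  end.

Lemma aug_le_refl r b : reflexive (@aug_le r b).
Proof. by case=> //= u; rewrite /cell_le !leqnn. Qed.

Lemma aug_le_anti r b : antisymmetric (@aug_le r b).
Proof.
case=> [u|] [v|] //= /andP[/andP[h1 h2] /andP[h3 h4]].
congr Some; apply/val_inj/eqP; rewrite -pair_eqE /pair_eq.
by rewrite !eqn_leq h1 h2 h3 h4.
Qed.

Lemma aug_le_trans r b : transitive (@aug_le r b).
Proof.
case=> [v|] [u|] [w|] //= /andP[h1 h2] /andP[h3 h4].
by rewrite /cell_le (leq_trans h3 h1) (leq_trans h2 h4).
Qed.

Fact aug_ferrers_display : Order.disp_t. Proof. exact: Order.Disp tt tt. Qed.

HB.instance Definition _ r b :=
  Order.Le_isPOrder.Build aug_ferrers_display (aug_ferrers r b)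
    (@aug_le_refl r b) (@aug_le_anti r b) (@aug_le_trans r b).

(* Cells satisfy i <= c, so the natural-number subtraction is exact. *)
Definition aug_rank r b (u : aug_ferrers r b) : nat :=
  if u is Some v then ((val v).2 - (val v).1 + 1)%N else 0%N.

(* Main.v *)
(* Fix [x] and let N_z be the numerator of [x, z], where z has rank n above x.
   Dividing out the occurrences of z turns it into the numerator for the weak
   chains of [x, z), over the denominator with one factor fewer.  In these posets
   [x, z) is either a single interval [x, p], so that N_z = N_p, or a union of
   two intervals [x, p] and [x, w] meeting in an interval [x, m] with m of rank
   n - 2.  A chain with all its elements in the union lies in one of the two
   intervals, whence
     N_z = N_p + N_w - (1 - q^(n-1) t) N_m
         = N_p + (N_w - N_m) + q^(n-1) t N_m,
   and induction shows both that N_z is coefficientwise nonnegative and that it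
   grows along cover relations. *)
Require Import Defs.
From HB Require Import structures.
From mathcomp Require Import all_boot all_order all_algebra.
From mathcomp Require Import zify ring.

Set Implicit Arguments.
Unset Strict Implicit.
Unset Printing Implicit Defensive.

Import Order.TTheory GRing.Theory Num.Theory.

Local Open Scope ring_scope.

(** * Product of a polynomial and a formal power series, by coefficients *)

Section Convolution.

Variable R : comNzRingType.
Implicit Types (D E N : {poly R}) (A B : nat -> R).

Definition conv D A n : R := \sum_(k < n.+1) D`_k * A (n - k)%N.

Lemma eq_conv D A B : A =1 B -> conv D A =1 conv D B.
Proof. by move=> eAB n; apply: eq_bigr => k _; rewrite eAB. Qed.

Lemma conv_coef D N n : conv D (fun k => N`_k) n = (D * N)`_n.
Proof. by rewrite coefM. Qed.

Lemma convD D A B n : conv D (fun k => A k + B k) n = conv D A n + conv D B n.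
Proof. by rewrite -big_split; apply: eq_bigr => k _; rewrite mulrDr. Qed.

Lemma conv_trunc D A m n :
  (n < m)%N -> (D * \poly_(i < m) A i)`_n = conv D A n.
Proof.
move=> lt_nm; rewrite coefM; apply: eq_bigr => k _.
by rewrite coef_poly (leq_ltn_trans (leq_subr _ _) lt_nm).
Qed.

(** Coefficients up to degree [n] involve [A] only up to [n], so [A] may be truncated to a
    polynomial, where multiplication is associative. *)
Lemma convM D E A n : conv (D * E) A n = conv D (conv E A) n.
Proof.
rewrite -(conv_trunc _ _ (ltnSn n)) -mulrA coefM; apply: eq_bigr => k _.
by rewrite conv_trunc // ltnS leq_subr.
Qed.

End Convolution.

(** * Weak chains: removing a maximum, and inclusion-exclusion *)

Section Chains.

Variables (d : Order.disp_t) (T : finPOrderType d).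
Implicit Types (P Q : {set T}) (rho : T -> nat) (s : seq T).

Lemma sorted_rcons_le s z : sorted (fun x y : T => (x <= y)%O) (rcons s z)
  = all (fun u => (u <= z)%O) s && sorted (fun x y : T => (x <= y)%O) s.
Proof. by rewrite !sorted_pairwise ?pairwise_rcons //; apply: le_trans. Qed.

Lemma sorted_le_last s v : sorted (fun x y : T => (x <= y)%O) s ->
  {in s, forall u, (u <= last v s)%O}.
Proof.
elim/last_ind: s => // s w _; rewrite sorted_rcons_le // last_rcons.
case/andP=> /allP le_sw _ u.
by rewrite mem_rcons inE => /predU1P[->|/le_sw].
Qed.

Lemma qzeta_nil P rho : qzeta P rho 0 = 1.
Proof.
rewrite /qzeta (big_pred1 [tuple]) ?big_nil ?expr0 // => s.
by rewrite [s]tuple0; symmetry; apply/eqP.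
Qed.

(** A nonempty weak chain either ends in [z], and is then a shorter chain with [z] appended, or
    avoids [z] altogether. *)
Lemma qzeta_top P rho z : z \in P -> {in P, forall u, (u <= z)%O} ->
  conv (1 - ('X^(rho z) : {poly int}) *: 'X) (qzeta P rho)
    =1 qzeta (P :\ z) rho.
Proof.
move=> Pz Ple [|n].
  by rewrite /conv big_ord1 !coefE !qzeta_nil mulr0 subr0 mulr1.
rewrite /conv big_ord_recl big_ord_recl big1 => [|k _]; last first.
  by rewrite !coefE /= mulr0 subr0 mul0r.
rewrite !coefE /= !subn0 mulr0 mulr1 subr0 mul1r sub0r addr0 subSS subn0.
apply/eqP; rewrite mulNr subr_eq; apply/eqP.
have last_in (s : n.+1.-tuple T) : last z s \in s.
  by case: s => -[|a l] i //; exact: (mem_last a l).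
rewrite {1}/qzeta (bigID (fun s : n.+1.-tuple T => last z s != z)) /=.
congr (_ + _).
  apply: eq_bigl => s; rewrite /weak_chain.
  case: (boolP (sorted _ s)) => [ss|]; last by rewrite !andbF.
  rewrite !andbT; apply/andP/allP => [[/allP sP lz] u su|sP].
    (* If [z] occurred, the last entry would be both at least and at most [z]. *)
    rewrite !inE (sP _ su : u \in P) andbT; apply: contraNneq lz => uz.
    by rewrite eq_le (Ple _ (sP _ (last_in s))) -{1}uz sorted_le_last.
  split; first by apply/allP => u /sP; rewrite inE => /andP[].
  by have /sP := last_in s; rewrite !inE => /andP[].
rewrite /qzeta big_distrr /=.
pose h (s : n.-tuple T) := [tuple of rcons s z].
pose h' (s : n.+1.-tuple T) := [tuple of belast (thead s) (behead s)].
rewrite (reindex_onto h h') /= => [|s]; last first.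
  case/andP=> _; rewrite negbK => /eqP lz.
  apply/val_inj => /=; case/tupleP: s lz => a l /= lz.
  by rewrite theadE -lz -lastI.
apply: eq_big => [s|s _]; last first.
  by rewrite -exprD big_rcons addnC.
rewrite last_rcons eqxx andbT.
have -> : h' (h s) == s.
  apply/eqP/val_inj; rewrite /= /thead (tnth_nth z) /=.
  case: s => -[|a l] i //=; exact: belast_rcons.
rewrite andbT /weak_chain all_rcons Pz sorted_rcons_le //=.
case: (boolP (all _ s)) => //= /allP sP.
by case: (sorted _ _); rewrite ?andbF ?andbT //; apply/allP => u /sP /Ple.
Qed.

(** Both sets are down-closed in the union, so the last entry of a chain decides which of them
    contains the whole chain. *)
Lemma qzeta_modular P Q rho :
  {in P :|: Q & P, forall u v, (u <= v)%O -> u \in P} ->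
  {in P :|: Q & Q, forall u v, (u <= v)%O -> u \in Q} ->
  forall n, qzeta (P :|: Q) rho n + qzeta (P :&: Q) rho n
            = qzeta P rho n + qzeta Q rho n.
Proof.
move=> lowP lowQ n; rewrite /qzeta ![\sum_(_ | weak_chain _ _) _]big_mkcond.
rewrite -!big_split; apply: eq_bigr => s _ /=; rewrite /weak_chain.
case: (boolP (sorted _ s)) => [ss|]; last by rewrite !andbF.
rewrite !andbT.
have -> : all [in P :&: Q] s = all [in P] s && all [in Q] s.
  by rewrite -all_predI; apply: eq_all => u; rewrite /= inE.
have -> : all [in P :|: Q] s = all [in P] s || all [in Q] s.
  apply/idP/orP => [/allP sPQ|[] /allP sP]; last first.
  - by apply/allP => u /sP uP; apply/setUP; right.
  - by apply/allP => u /sP uP; apply/setUP; left.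
  case E : (tval s) => [|a l]; first by left.
  have ls : last a s \in tval s by rewrite E /= mem_last.
  have le_l u : u \in tval s -> (u <= last a s)%O by apply: sorted_le_last.
  by case/setUP: (sPQ _ ls) => lPQ; [left|right];
     rewrite -E; apply/allP => u su;
     [apply: lowP lPQ (le_l u su)|apply: lowQ lPQ (le_l u su)];
     apply: sPQ.
by case: (all [in P] s); case: (all [in Q] s); rewrite /= ?addr0 ?add0r.
Qed.

End Chains.

(** * Numerators when each element has at most two lower covers above [x] *)

Section LowerCovers.

Variables (d : Order.disp_t) (T : finPOrderType d) (rho : T -> nat) (x : T).
Hypothesis rho_mono : {homo rho : u v / (u < v)%O >-> (u < v)%N}.

Local Notation Z z := (qzeta (order_interval x z) (interval_rank rho x)).
Local Notation numerator z N :=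
  (is_qzeta_numerator (order_interval x z) (interval_rank rho x) N).
Local Notation nonneg N :=
  (N \is a polyOver (polyOver_pred (@Num.Def.nneg_num_pred int))).

Definition denom n : {poly {poly int}} :=
  \prod_(a < n) (1 - ('X^a : {poly int}) *: 'X).

Lemma denomS n :
  denom n.+1 = (1 - ('X^n : {poly int}) *: 'X) * denom n.
Proof. by rewrite /denom big_ord_recr mulrC. Qed.

Lemma max_rank_interval z : (x <= z)%O ->
  max_rank (order_interval x z) (interval_rank rho x) = (rho z - rho x)%N.
Proof.
move=> xz; apply/eqP; rewrite eqn_leq; apply/andP; split.
  apply/bigmax_leqP => u; rewrite inE => /andP[_].
  by rewrite le_eqVlt => /predU1P[->//|/rho_mono/ltnW]; apply: leq_sub2r.
by apply: (@leq_bigmax_cond _ _ (interval_rank rho x)); rewrite inE xz lexx.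
Qed.

Lemma numeratorE z n (N : {poly {poly int}}) : (x <= z)%O -> rho z = (rho x + n)%N ->
  numerator z N <-> conv (denom n.+1) (Z z) =1 (fun k => N`_k).
Proof.
move=> xz zn; rewrite /is_qzeta_numerator /qzeta_denominator.
by rewrite max_rank_interval // zn addKn.
Qed.

(** The top has relative rank [n], so removing it by [qzeta_top] cancels exactly the last factor of
    [denom n.+1]. *)
Lemma numerator_below z n (N : {poly {poly int}}) : (x <= z)%O -> rho z = (rho x + n)%N ->
  conv (denom n) (qzeta (order_interval x z :\ z) (interval_rank rho x))
    =1 (fun k => N`_k) -> numerator z N.
Proof.
move=> xz zn hN; apply/(numeratorE _ xz zn) => k.
rewrite denomS mulrC convM -hN; apply: eq_conv => {}k.
have -> : n = interval_rank rho x z by rewrite /interval_rank zn addKn.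
apply: qzeta_top; rewrite ?inE ?xz ?lexx // => u.
by rewrite inE => /andP[].
Qed.

Definition at_most_two_covers z : Prop :=
  (exists p, [/\ (x <= p)%O, rho z = (rho p).+1 &
     forall u, (x <= u)%O -> (u < z)%O = (u <= p)%O]) \/
  (exists p w m, [/\ (x <= m)%O, rho z = (rho p).+1, rho z = (rho w).+1,
     rho z = (rho m).+2 & forall u, (x <= u)%O ->
     (u < z)%O = (u <= p)%O || (u <= w)%O /\
     (u <= m)%O = (u <= p)%O && (u <= w)%O]).

Hypothesis covers : forall z, (x < z)%O -> at_most_two_covers z.

Lemma eq_of_rank u v : (u <= v)%O -> rho u = rho v -> u = v.
Proof.
rewrite le_eqVlt => /predU1P[//|/rho_mono + uv].
by rewrite uv ltnn.
Qed.

(** The growth clause strengthens the induction: with two lower intervals, nonnegativity rests on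
    [Nw - Nm], a difference along a cover. *)
Lemma numerator_nonneg z : (x <= z)%O ->
  exists N, [/\ numerator z N, nonneg N & forall p N', (x <= p)%O -> (p < z)%O ->
    rho z = (rho p).+1 -> numerator p N' -> nonneg (N - N')].
Proof.
have [n le_zn] := ubnP (rho z); elim: n => // n IH in z le_zn *.
rewrite le_eqVlt => /predU1P[zx|xz].
  (* Removing [x] from [[x, x]] leaves only the empty chain, and [denom 0] is 1. *)
  exists 1; split; last 2 first.
  - exact: rpred1.
  - by move=> p N' xp; rewrite -zx (le_gtF xp).
  apply: (@numerator_below _ 0); rewrite -?zx ?addn0 // => k.
  rewrite /denom big_ord0 /conv big_ord_recl big1 => [|i _]; last first.
    by rewrite coef1 mul0r.
  rewrite addr0 subn0 !coef1 mul1r.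
  case: k => [|k]; first by rewrite qzeta_nil.
  rewrite /qzeta big_pred0 // => s; rewrite /weak_chain.
  case/tupleP: s => a l /=; rewrite !inE.
  by case: (a =P x) => //= ax; rewrite -eq_le eq_sym; case: eqP ax.
have rz := rho_mono xz.
case: (covers xz) => [[p [xp rp lp]]|[p [w [m [xm rp rw rm lpw]]]]].
  have [|Np [hNp Np0 _]] := IH p _ xp; first by rewrite -ltnS -rp.
  exists Np; split=> //; last first.
    move=> p' N' xp' + rp' hN'; rewrite lp // => pp'.
    have e : p' = p by apply: eq_of_rank pp' _; apply: succn_inj; rewrite -rp.
    by rewrite e in hN'; rewrite (qzeta_numerator_uniq hNp hN') subrr rpred0.
  have [k rk] : exists k, rho p = (rho x + k)%N.
    by exists (rho p - rho x)%N; rewrite subnKC // -ltnS -rp.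
  apply: (@numerator_below _ k.+1); rewrite ?(ltW xz) //.
    by rewrite rp rk addnS.
  have -> : order_interval x z :\ z = order_interval x p.
    apply/setP => u; rewrite !inE andbCA -lt_neqAle.
    by case: (boolP (x <= u)%O) => //= /lp.
  exact/numeratorE.
(* The intersection clause at [u = m] puts [m] below both [p] and [w]. *)
have [mp mw] : (m <= p)%O /\ (m <= w)%O.
  by apply/andP; have [_ <-] := lpw m xm; rewrite lexx.
have xp := le_trans xm mp; have xw := le_trans xm mw.
have [|Np [hNp Np0 Npd]] := IH p _ xp; first by rewrite -ltnS -rp.
have [|Nw [hNw Nw0 Nwd]] := IH w _ xw; first by rewrite -ltnS -rw.
have [|Nm [hNm Nm0 _]] := IH m _ xm; first by rewrite rm ltnS in le_zn; apply: ltnW.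
have rpm : rho p = (rho m).+1 by apply: succn_inj; rewrite -rp.
have rwm : rho w = (rho m).+1 by apply: succn_inj; rewrite -rw.
have dp : nonneg (Np - Nm).
  apply: (Npd m) => //; rewrite lt_neqAle mp andbT.
  by apply/eqP => e; apply: (n_Sn (rho p)); rewrite -{2}e.
have dw : nonneg (Nw - Nm).
  apply: (Nwd m) => //; rewrite lt_neqAle mw andbT.
  by apply/eqP => e; apply: (n_Sn (rho w)); rewrite -{2}e.
have [k rk] : exists k, rho m = (rho x + k)%N.
  exists (rho m - rho x)%N; rewrite subnKC //.
  by move: xm; rewrite le_eqVlt => /predU1P[->//|/rho_mono/ltnW].
(* Since [z] has relative rank [k+2], this is the factor of [denom k.+2] that [denom k.+1] lacks,
   subtracted from 1. *)
pose U : {poly {poly int}} := ('X^(k.+1) : {poly int}) *: 'X.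
have U0 : nonneg (U * Nm).
  by rewrite rpredM // polyOverZ ?polyOverX // rpredX // polyOverX.
exists (Np + (Nw - Nm) + U * Nm); split.
- apply: (@numerator_below _ k.+2); rewrite ?(ltW xz) ?rm ?rk ?addnS //.
  have eU : order_interval x z :\ z = order_interval x p :|: order_interval x w.
    apply/setP => u; rewrite !inE andbCA -lt_neqAle -andb_orr.
    by case: (boolP (x <= u)%O) => //= /lpw[].
  have eI : order_interval x m = order_interval x p :&: order_interval x w.
    apply/setP => u; rewrite !inE.
    by case: (boolP (x <= u)%O) => //= /lpw[].
  have mod j : qzeta (order_interval x z :\ z) (interval_rank rho x) j + Z m j
      = Z p j + Z w j.
    rewrite eU eI; apply: qzeta_modular => u v;
      rewrite !inE -andb_orr => /andP[-> _] /andP[_ le_v] le_uv;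
      exact: le_trans le_v.
  (* With the [m] term on both sides the goal is inclusion-exclusion; over [denom k.+2] that term
     comes from [(1 - U) * Nm]. *)
  move=> j; apply: (addIr (conv (denom k.+2) (Z m) j)).
  rewrite -convD (eq_conv _ mod) convD.
  have hp : conv (denom k.+2) (Z p) =1 (fun i => Np`_i).
    by apply/numeratorE => //; rewrite rpm rk addnS.
  have hw : conv (denom k.+2) (Z w) =1 (fun i => Nw`_i).
    by apply/numeratorE => //; rewrite rwm rk addnS.
  have hm : conv (denom k.+1) (Z m) =1 (fun i => Nm`_i).
    exact/numeratorE.
  rewrite hp hw denomS convM (eq_conv _ hm) conv_coef.
  by rewrite -/U mulrBl mul1r !coefD !coefN; ring.
- exact: (rpredD (rpredD Np0 dw) U0).
(* By rank, [p'] is [p] or [w]; subtracting its numerator leaves [U * Nm] plus the growth from [Nm]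
   to the other numerator. *)
move=> p' N' xp' + rp' hN'; have [-> _] := lpw p' xp'.
case/orP => le_p'.
  have e : p' = p by apply: eq_of_rank le_p' _; apply: succn_inj; rewrite -rp.
  rewrite e in hN'; rewrite -(qzeta_numerator_uniq hNp hN').
  have -> : Np + (Nw - Nm) + U * Nm - Np = (Nw - Nm) + U * Nm by ring.
  exact: rpredD dw U0.
have e : p' = w by apply: eq_of_rank le_p' _; apply: succn_inj; rewrite -rw.
rewrite e in hN'; rewrite -(qzeta_numerator_uniq hNw hN').
have -> : Np + (Nw - Nm) + U * Nm - Nw = (Np - Nm) + U * Nm by ring.
exact: rpredD dp U0.
Qed.

End LowerCovers.

(** * Lower covers in the augmented Ferrers-cell poset *)

Section AugFerrers.

Variables (r : nat) (b : nat -> nat).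
Hypothesis hdecr : forall i j : nat, (1 <= i)%N -> (i <= j)%N -> (j <= r)%N ->
  (b j <= b i)%N.

Definition row (u : ferrers_cell r b) : nat := (val u).1.
Definition col (u : ferrers_cell r b) : nat := (val u).2.

Lemma cellP (u : ferrers_cell r b) :
  [/\ (1 <= row u)%N, (row u <= r)%N, (row u <= col u)%N
    & (col u <= b (row u))%N].
Proof.
case: u => -[i c] h; rewrite /row /col /=; move: (h).
by rewrite mem_ferrers_cells => /andP[/andP[? ?] /andP[? ?]].
Qed.

Lemma cell_ex i c : (1 <= i <= r)%N && (i <= c <= b i)%N ->
  exists2 w : ferrers_cell r b, row w = i & col w = c.
Proof. by rewrite -mem_ferrers_cells => h; exists (SeqSub h). Qed.

Lemma le_cellE (u v : ferrers_cell r b) :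
  (Some u <= Some v :> aug_ferrers r b)%O
  = (row v <= row u)%N && (col u <= col v)%N.
Proof. by []. Qed.

Lemma le_bottomE (u : aug_ferrers r b) :
  ((None : aug_ferrers r b) <= u)%O = true.
Proof. by []. Qed.

Lemma le_cell_bottom (u : ferrers_cell r b) :
  (Some u <= None :> aug_ferrers r b)%O = false.
Proof. by []. Qed.

Lemma rank_cell (u : ferrers_cell r b) :
  @aug_rank r b (Some u) = (col u - row u + 1)%N.
Proof. by []. Qed.

Lemma rank_bottom : @aug_rank r b None = 0%N.
Proof. by []. Qed.

Lemma aug_rank_mono :
  {homo (@aug_rank r b) : u v / (u < v)%O >-> (u < v)%N}.
Proof.
move=> [u|] [v|]; rewrite lt_leAnge ?le_bottomE ?le_cell_bottom ?andbF //.
  rewrite !le_cellE !rank_cell.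
  by case: (cellP u) (cellP v) => ? ? ? ? [? ? ? ?]; lia.
by rewrite rank_cell rank_bottom addn1.
Qed.

(* Taking [(J, C) = (r, 1)] for the bottom element makes the description of the
   cells above [x] uniform. *)
Lemma above_bounds (x : aug_ferrers r b) : exists J C,
  [/\ (J <= r)%N, (1 <= C)%N,
   forall w, (x <= Some w)%O = (row w <= J)%N && (C <= col w)%N
   & if x is Some u then [/\ J = row u, C = col u & (J <= C)%N]
     else J = r /\ C = 1%N].
Proof.
case: x => [u|]; last first.
  exists r, 1%N; split=> // w; rewrite le_bottomE.
  by case: (cellP w) => ? ? ? _; lia.
by exists (row u), (col u); case: (cellP u) => *; split=> //; lia.
Qed.

(** Below a cell [(i, e)] the candidates are [(i+1, e)] and [(i, e-1)], meeting in [(i+1, e-1)] or,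
    if that is no cell, in the bottom. Either candidate may fail to be a cell or to lie above
    [x]. *)
Lemma aug_ferrers_covers (x z : aug_ferrers r b) : (x < z)%O ->
  at_most_two_covers (@aug_rank r b) x z.
Proof.
case: z => [v|]; last by case: x => [u|]; rewrite lt_leAnge ?le_bottomE ?andbF.
have [J [C [Jr C1 aboveE xJC]]] := above_bounds x.
have [i1 ir ie eb] := cellP v.
rewrite lt_leAnge aboveE => /andP[xv nvx].
have lt_vE u : (Some u < Some v :> aug_ferrers r b)%O
    = [&& row v <= row u, col u <= col v
        & (row v < row u) || (col u < col v)]%N.
  by rewrite lt_leAnge !le_cellE; clear; lia.
have lt_bot : ((None : aug_ferrers r b) < Some v)%O by [].
(* As [b] is weakly decreasing, the row just after that of [v] bounds the columns of all later
   rows. *)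
have bounds u : (x <= Some u)%O -> [/\ row u <= J, C <= col u, row u <= r,
    row u <= col u & row v < row u -> col u <= b (row v).+1]%N.
  rewrite aboveE => /andP[xu1 xu2]; have [u1 ur ue ub] := cellP u.
  by split=> // vu; apply: leq_trans ub _; apply: hdecr.
have hbi : (row v < r)%N -> (b (row v).+1 <= b (row v))%N.
  by move=> ?; apply: hdecr.
have xnone : x != None -> [/\ J <= C, (row v < J) || (C < col v)
    & row v < J -> C <= b (row v).+1]%N.
  case: (x) xJC nvx bounds => // u [-> -> uJC] + bnd _; rewrite le_cellE => nvx.
  have [|_ _ _ _ hb] := bnd u; first by rewrite le_cellE !leqnn.
  by split=> //; lia.
set B := b (row v).+1 in bounds hbi xnone.
have vE := rank_cell v.
move Ei: (row v) lt_vE i1 ir ie eb xv bounds hbi xnone vE => i.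
move Ee: (col v) => e lt_vE i1 ir ie eb xv bounds hbi xnone vE.
(* [hp] says that [(i+1, e)] is a cell above [x], and [hw] says so of [(i, e-1)]. *)
case: (boolP [&& i < r, i < e, e <= B & i < J]%N) => hp;
  case: (boolP ((i < e)%N && (C < e)%N)) => hw.
- have [|p pi pe] := @cell_ex i.+1 e; first by rewrite -Ei -/B; lia.
  have [|w wi we] := @cell_ex i e.-1; first by lia.
  right; case: (leqP e i.+1) => he.
    (* Here [e = i+1]: no cell lies below both candidates, so [x] is the bottom and serves as
       [m]. *)
    have x0 : x = None.
      by apply/eqP; apply: contraT => /xnone[]; lia.
    exists (Some p), (Some w), None.
    rewrite vE !rank_cell rank_bottom x0 pi pe wi we; split; try lia.
      by rewrite le_bottomE.
    case=> [u|] _; last by rewrite lt_bot !le_bottomE.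
    have [|u1 u2 u3 u4 u5] := bounds u; first by rewrite x0 le_bottomE.
    by rewrite lt_vE !le_cellE le_cell_bottom pi pe wi we; split; lia.
  have [|m mi me] := @cell_ex i.+1 e.-1; first by rewrite -Ei -/B; lia.
  exists (Some p), (Some w), (Some m).
  rewrite aboveE vE !rank_cell pi pe wi we mi me; split; try lia.
  case=> [u|] xu; last by rewrite lt_bot !le_bottomE.
  have [u1 u2 u3 u4 u5] := bounds u xu.
  by rewrite lt_vE !le_cellE pi pe wi we mi me; split; lia.
(* Now [e = C], so cells above [x] and strictly below [v] lie in later rows. *)
- have [|p pi pe] := @cell_ex i.+1 e; first by rewrite -Ei -/B; lia.
  left; exists (Some p); rewrite aboveE vE rank_cell pi pe; split; try lia.
  case=> [u|] xu; last by rewrite lt_bot !le_bottomE.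
  have [u1 u2 u3 u4 u5] := bounds u xu.
  by rewrite lt_vE !le_cellE pi pe; lia.
(* Either no row past [i] meets the interval, or those rows stop before column [e]. *)
- have [|w wi we] := @cell_ex i e.-1; first by lia.
  left; exists (Some w); rewrite aboveE vE rank_cell wi we; split; try lia.
  case=> [u|] xu; last by rewrite lt_bot !le_bottomE.
  have [u1 u2 u3 u4 u5] := bounds u xu.
  by rewrite lt_vE !le_cellE wi we; lia.
(* A cell [x] strictly below [v] would make one candidate available. So [x] is the bottom, and [v]
   is a diagonal cell with only the bottom below it. *)
have x0 : x = None.
  by apply/eqP; apply: contraT => /xnone[]; lia.
left; exists None; rewrite vE rank_bottom x0 in xJC *; case: xJC => ? ?.
split; first (by rewrite le_bottomE); first by lia.
case=> [u|] _; last by rewrite lt_bot !le_bottomE.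
have [|u1 u2 u3 u4 u5] := bounds u; first by rewrite x0 le_bottomE.
by rewrite lt_vE le_cell_bottom; lia.
Qed.

End AugFerrers.

Theorem corollary5p9 (r : nat) (b : nat -> nat)
    (hr : (1 <= r)%N)
    (hdecr : forall i j : nat, (1 <= i)%N -> (i <= j)%N -> (j <= r)%N ->
       (b j <= b i)%N)
    (hb : forall i : nat, (1 <= i)%N -> (i <= r)%N -> (i <= b i)%N)
    (x y : aug_ferrers r b) (hxy : (x <= y)%O) :
  exists N : {poly {poly int}},
    is_qzeta_numerator (order_interval x y) (interval_rank (@aug_rank r b) x) N /\
    (forall i j : nat, 0 <= (N`_i)`_j).
Proof.
have covers z := @aug_ferrers_covers r b hdecr x z.
have [N [hN N0 _]] := numerator_nonneg (@aug_rank_mono r b) covers hxy.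
exists N; split=> // i j.
by move/polyOverP/(_ i)/polyOverP/(_ j): N0; rewrite nnegrE.
Qed.
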